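(* Let $n\ge0$ and $r\in\mathbb{Z}$. (i) Assume all objects in the following identity are defined, i.e. $D_m^{(r)}\ne0$ for $n\le m\le n+3$, $D_m^{(r-1)}\neq0$ for $n\le m\le n+2$, and $D_{n+1}^{(r-2)}\ne0$. Then $$P_{n+3}(z;r)-(\delta_{n+2}^{(r)}+\delta_{n+1}^{(r-1)})P_{n+2}(z;r)+(\delta_{n+1}^{(r-1)}\delta_{n+1}^{(r)}-z^2)P_{n+1}(z;r)+(\delta_n^{(r)}+\eta_n^{(r-2)})z^2P_n(z;r)=0.$$ (ii) Assume all objects in the following identity are defined, i.e. $D_m^{(r)}\ne0$ for $n\le m\le n+3$, $D_m^{(r+1)}\ne0$ for $m=n+1,n+2$, $D_m^{(r+2)}\ne0$ for $n\le m\le n+2$, and $D_{n+1}^{(r+3)}\ne0$. Then $$Q^*_{n+3}(z;r)-(1+\beta_{n+2}^{(r)}z)Q^*_{n+2}(z;r)+(\beta_{n+1}^{(r)}+\alpha_{n+1}^{(r+1)}+\beta_{n+1}^{(r+1)}+\alpha_{n+1}^{(r+2)})zQ^*_{n+1}(z;r)-(\beta_{n+1}^{(r+1)}+\alpha_{n+1}^{(r+2)})(\beta_n^{(r)}+\alpha_n^{(r+1)})z^2Q^*_n(z;r)=0.$$ Here $$\delta_n^{(r)}=-\frac{h_n^{(r-1)}}{h_n^{(r)}},\quad \eta_n^{(r)}=\frac{D_n^{(r+2)}D_{n+1}^{(r-1)}}{D_{n+1}^{(r)}D_n^{(r+1)}},\quad \beta_n^{(r)}=-\frac{h_n^{(r+2)}}{h_n^{(r)}},\quad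 \alpha_n^{(r)}=\frac{D_n^{(r-1)}D_{n+1}^{(r+2)}}{D_{n+1}^{(r)}D_n^{(r+1)}}.$$
   Context: $\mathbb{T}$ is the unit circle, oriented counterclockwise; $w$ is a complex-valued integrable weight on $\mathbb{T}$ with Fourier coefficients $w_k=\int_{\mathbb{T}}\zeta^{-k}w(\zeta)\frac{d\zeta}{2\pi i\zeta}$. For $n\ge1$, $D_n^{(r)}=\det(w_{r+2j-k})_{0\le j,k\le n-1}$ ($j$ row index, $k$ column index), and $D_0^{(r)}=1$. When $D_n^{(r)}\ne0$, $P_n(z;r)$ and $Q_n(z;r)$ are the unique monic polynomials of degree $n$ with $\int_{\mathbb{T}}P_n(\zeta;r)\zeta^{-2m-r}w(\zeta)\frac{d\zeta}{2\pi i\zeta}=0$ and $\int_{\mathbb{T}}Q_n(\zeta^{-2};r)\zeta^{m-r}w(\zeta)\frac{d\zeta}{2\pi i\zeta}=0$ for $0\le m\le n-1$; for $m=n$ both integrals equal $h_n^{(r)}=D_{n+1}^{(r)}/D_n^{(r)}$. The reciprocal polynomial is $Q_n^*(z;r)=z^nQ_n(z^{-1};r)$. *)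

(* Defs.v *)
From HB Require Import structures.
From mathcomp Require Import all_boot all_order all_algebra.
From mathcomp Require Import complex.
From mathcomp Require Import all_classical all_reals all_analysis.

Set Implicit Arguments.
Unset Strict Implicit.
Unset Printing Implicit Defensive.

Import Order.TTheory GRing.Theory Num.Theory.

Local Open Scope ring_scope.
Local Open Scope complex_scope.

Section Circle.
Variable R : realType.
Implicit Types (f g w : R[i] -> R[i]) (t : R).

Definition circle_pt t : R[i] := cos t +i* sin t.

(* Complex-valued Lebesgue integral, taken on real and imaginary parts. *)
Definition cintegral (D : set R) (F : R -> R[i]) : R[i] :=
  (\int[lebesgue_measure]_(t in D) complex.Re (F t))
  +i* (\int[lebesgue_measure]_(t in D) complex.Im (F t)).

(* The integral of g(zeta) d zeta over the unit circle, with the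
   counterclockwise parametrization zeta = e^{it}, d zeta = i e^{it} dt. *)
Definition contour_integral g : R[i] :=
  cintegral `[0, pi *+ 2]%classic (fun t => g (circle_pt t) * ('i * circle_pt t)).

(* The integral of f(zeta) d zeta / (2 pi i zeta) over the unit circle. *)
Definition circle_integral f : R[i] :=
  contour_integral (fun zeta => f zeta / ((pi *+ 2)%:C * 'i * zeta)).

(* Only the values of w on the unit circle are ever used. *)
Definition integrable_weight w : Prop :=
  lebesgue_measure.-integrable `[0, pi *+ 2]%classic
    (fun t => (complex.Re (w (circle_pt t)))%:E) /\
  lebesgue_measure.-integrable `[0, pi *+ 2]%classic
    (fun t => (complex.Im (w (circle_pt t)))%:E).

Definition fourier_coef w (k : int) : R[i] :=
  circle_integral (fun zeta => zeta ^ (- k) * w zeta).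

End Circle.

(* Throughout, an object written X_n^{(r)} on paper is X w n r here. *)
Section Toeplitz.
Variables (R : realType) (w : R[i] -> R[i]).
Implicit Types (n : nat) (r : int).

Definition D n r : R[i] :=
  \det (\matrix_(j < n, k < n) fourier_coef w (r + 2 * (j : nat)%:Z - (k : nat)%:Z)).

Definition is_P n r (p : {poly R[i]}) : Prop :=
  [/\ p \is monic, size p = n.+1 &
   forall m, (m < n)%N ->
     circle_integral (fun zeta =>
       p.[zeta] * zeta ^ (- 2 * m%:Z - r) * w zeta) = 0].

Definition is_Q n r (q : {poly R[i]}) : Prop :=
  [/\ q \is monic, size q = n.+1 &
   forall m, (m < n)%N ->
     circle_integral (fun zeta =>
       q.[zeta ^- 2] * zeta ^ (m%:Z - r) * w zeta) = 0].

(* When D n r != 0 there is exactly one polynomial satisfying is_P n r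
   (resp. is_Q n r), and P n r (resp. Q n r) is that polynomial. *)
Definition P n r : {poly R[i]} := xget 0 [set p | is_P n r p]%classic.

Definition Q n r : {poly R[i]} := xget 0 [set q | is_Q n r q]%classic.

(* Q*_n(z) = z^n Q_n(1/z), as a polynomial: the coefficients are reversed, so
   that the value at z = 0 is correct (in MathComp 0^-1 = 0). *)
Definition reciprocal n (q : {poly R[i]}) : {poly R[i]} :=
  \poly_(i < n.+1) q`_(n - i).

Lemma reciprocalE n (q : {poly R[i]}) (z : R[i]) :
  (size q <= n.+1)%N -> z != 0 -> (reciprocal n q).[z] = z ^+ n * q.[z^-1].
Proof.
move=> sq z0; rewrite horner_poly (horner_coef_wide _ sq) big_distrr /=.
rewrite (reindex_inj rev_ord_inj) /=; apply: eq_bigr => i _.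
have lein : (i <= n)%N by rewrite -ltnS.
rewrite subSS subKn // mulrCA; congr (_ * _).
by rewrite exprVn expfB_cond ?lein // (negbTE z0).
Qed.

Definition Qstar n r : {poly R[i]} := reciprocal n (Q n r).

Definition h n r : R[i] := D n.+1 r / D n r.

Definition delta n r : R[i] := - (h n (r - 1) / h n r).

Definition eta n r : R[i] :=
  (D n (r + 2) * D n.+1 (r - 1)) / (D n.+1 r * D n (r + 1)).

Definition beta n r : R[i] := - (h n (r + 2) / h n r).

Definition alpha n r : R[i] :=
  (D n (r - 1) * D n.+1 (r + 2)) / (D n.+1 r * D n (r + 1)).

End Toeplitz.

(* Main.v *)
Require Import Defs.
From mathcomp Require Import all_boot all_order all_algebra.
From mathcomp Require Import complex.
From mathcomp Require Import all_classical all_reals all_analysis.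
From mathcomp Require Import zify ring.

(* For a kernel a(m, k), let p_n be the monic polynomial of degree n whose
   coefficients are orthogonal to the rows m < n of a.  Shifting the index k
   of a gives polynomials q_n with z q_n = p_{n+1} + c p_n, and shifting m gives
   polynomials s_n with p_{n+1} = s_{n+1} + c' s_n: in both cases the difference
   of the two leading terms has degree at most n and is orthogonal to n rows.
   Evaluating at z = 0, where p_n is a quotient of Gram determinants, yields c
   and c', so that no Jacobi determinant identity is needed.  P_n and Q_n are
   the cases a(m, k) = w_{r+2m-k} and w_{r+2k-m}; eliminating the polynomials
   with shifted r from four such relations gives each four-term recurrence. *)

Set Implicit Arguments.
Unset Strict Implicit.
Unset Printing Implicit Defensive.

Import Order.TTheory GRing.Theory Num.Theory.

Local Open Scope ring_scope.
Local Open Scope complex_scope.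

(** * Monic orthogonal polynomials of an abstract moment kernel *)

Section MonicOrthogonal.
Variable F : fieldType.
Implicit Types (a : nat -> nat -> F) (u : nat -> F) (p q : {poly F}).

(** The linear functional sending ['X^k] to [u k]. For a row of [P_kernel] or [Q_kernel] it becomes
    a circle integral against [w] times a power of zeta. *)
Definition moment u p : F := \sum_(k < size p) p`_k * u k.

Lemma moment_wide u p n :
  (size p <= n)%N -> moment u p = \sum_(k < n) p`_k * u k.
Proof.
move=> sp; rewrite /moment -!(big_mkord xpredT (fun k => p`_k * u k)).
rewrite [RHS](big_cat_nat (leq0n _) sp) /= [X in _ + X]big_nat_cond.
rewrite [X in _ + X]big1 ?addr0 // => k.
by rewrite andbT => /andP[sk _]; rewrite nth_default ?mul0r.
Qed.

Lemma momentB u p q : moment u (p - q) = moment u p - moment u q.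
Proof.
have [sp sq] := (leq_maxl (size p) (size q), leq_maxr (size p) (size q)).
rewrite (moment_wide _ sp) (moment_wide _ sq).
rewrite (@moment_wide u (p - q) (maxn (size p) (size q))).
  by rewrite -sumrB; apply: eq_bigr => k _; rewrite coefB mulrBl.
by rewrite (leq_trans (size_polyD _ _)) ?size_polyN.
Qed.

Lemma momentZ u c p : moment u (c *: p) = c * moment u p.
Proof.
rewrite (moment_wide _ (size_scale_leq c p)) /moment big_distrr /=.
by apply: eq_bigr => k _; rewrite coefZ mulrA.
Qed.

Lemma momentXM u p : moment u ('X * p) = moment (fun k => u k.+1) p.
Proof.
rewrite (@moment_wide u _ (size p).+1); last first.
  by rewrite (leq_trans (size_polyMleq _ _)) // size_polyX.
rewrite big_ord_recl coefXM mul0r add0r /moment; apply: eq_bigr => k _.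
by rewrite coefXM.
Qed.

Definition gram a n : F := \det (\matrix_(j < n, k < n) a j k).

Definition shift_row a : nat -> nat -> F := fun m k => a m.+1 k.
Definition shift_col a : nat -> nat -> F := fun m k => a m k.+1.

Definition monic_orth a n p : Prop :=
  [/\ p \is monic, size p = n.+1 &
      forall m, (m < n)%N -> moment (a m) p = 0].

(** The coefficient vector of [q] lies in the kernel of an invertible Gram matrix. *)
Lemma orth_eq0 a n q :
  gram a n != 0 -> (size q <= n)%N ->
  (forall m, (m < n)%N -> moment (a m) q = 0) -> q = 0.
Proof.
move=> nz sq q_orth; set A := \matrix_(j < n, k < n) a j k.
have uA : A \in unitmx by rewrite unitmxE unitfE.
have /(congr1 (mulmx (invmx A))) : A *m \col_k q`_k = 0.
  apply/matrixP => j i; rewrite !mxE -[RHS](q_orth j (ltn_ord j)).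
  rewrite (moment_wide _ sq); apply: eq_bigr => k _.
  by rewrite !mxE mulrC.
rewrite mulKmx // mulmx0 => /matrixP q0; apply/polyP => k; rewrite coef0.
have [kn|nk] := ltnP k n; last by rewrite nth_default // (leq_trans sq).
by have := q0 (Ordinal kn) ord0; rewrite !mxE.
Qed.

Lemma monic_orth_coef a n p : monic_orth a n p -> p`_n = 1.
Proof. by case=> /monicP <- sp _; rewrite lead_coefE sp. Qed.

(** Subtracting the multiple of [p] with the same coefficient of degree [n] lowers the degree below
    [n] and keeps the [n] orthogonality conditions, so [orth_eq0] applies. *)
Lemma orth_scale a n p q :
  gram a n != 0 -> monic_orth a n p -> (size q <= n.+1)%N ->
  (forall m, (m < n)%N -> moment (a m) q = 0) -> q = q`_n *: p.
Proof.
move=> nz pP sq q_orth; have [_ sp p_orth] := pP.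
apply/eqP; rewrite -subr_eq0; apply/eqP.
apply: (orth_eq0 nz).
  apply/leq_sizeP => k; rewrite leq_eqVlt coefB coefZ => /predU1P[<-|nk].
    by rewrite (monic_orth_coef pP) mulr1 subrr.
  rewrite (nth_default _ (leq_trans sq nk)) [p`_k]nth_default ?sp //.
  by rewrite mulr0 subrr.
by move=> m mn; rewrite momentB momentZ q_orth ?p_orth // mulr0 subrr.
Qed.

Lemma monic_orth_uniq a n p q :
  gram a n != 0 -> monic_orth a n p -> monic_orth a n q -> q = p.
Proof.
move=> nz pP qP; have [_ sq q_orth] := qP.
by rewrite (orth_scale nz pP _ q_orth) ?sq // (monic_orth_coef qP)
  scale1r.
Qed.

(* Normalised last column of the adjugate of the Gram matrix of order n.+1. *)
Lemma monic_orth_exists a n : gram a n != 0 ->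
  exists2 p, monic_orth a n p &
    p`_0 = (-1) ^+ n * gram (shift_col a) n / gram a n.
Proof.
move=> nz; set A := \matrix_(j < n.+1, k < n.+1) a j k.
pose p := \poly_(k < n.+1) (cofactor A ord_max (inord k) / gram a n).
have sp : (size p <= n.+1)%N by exact: size_poly.
have pn : p`_n = 1.
  rewrite coef_poly ltnSn /cofactor inordK //= addnn.
  rewrite -signr_odd odd_double mul1r.
  (* Deleting the last row and column leaves the Gram matrix of order [n], and the cofactor sign is
     (-1)^(n+n) = 1. *)
  suff -> : row' ord_max (col' (inord n) A) = \matrix_(j < n, k < n) a j k.
    by rewrite divff.
  apply/matrixP => j k; rewrite !mxE !lift_max.
  rewrite (_ : inord n = ord_max) ?lift_max //.
  by apply: val_inj; rewrite /= inordK.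
have ssp : size p = n.+1.
  apply/eqP; rewrite eqn_leq sp ltnNge.
  apply/negP => /leq_sizeP/(_ _ (leqnn n)).
  by rewrite pn; apply/eqP; rewrite oner_eq0.
exists p; first split=> //.
- by rewrite monicE lead_coefE ssp pn.
- move=> m mn; rewrite (moment_wide _ sp).
  (* Row [m] of [A] times the last column of the adjugate is an off-diagonal entry of det(A) I,
     hence zero because m < n. *)
  have := congr1 (fun B : 'M[F]_n.+1 => B (inord m) ord_max) (mul_mx_adj A).
  rewrite !mxE (_ : _ == _ = false); last first.
    by apply/eqP => /(congr1 val); rewrite /= inordK ?ltnS 1?ltnW // => mE;
      rewrite mE ltnn in mn.
  move/(congr1 (fun x => x / gram a n)); rewrite mulr0n mul0r mulr_suml.
  apply: etrans.
  apply: eq_bigr => k _; rewrite !mxE coef_poly ltn_ord inord_val inordK.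
    by rewrite mulrC mulrA.
  by rewrite ltnS ltnW.
(* For the constant coefficient, column 0 is deleted instead: column k+1 takes place k, which is
   [shift_col], and the sign is (-1)^n. *)
rewrite coef_poly /cofactor (_ : inord 0 = ord0); last first.
  by apply: val_inj; rewrite /= inordK.
rewrite addn0; congr (_ * \det _ / _).
by apply/matrixP => j k; rewrite !mxE lift_max lift0.
Qed.

Lemma monic_orth_coef0 a n p : gram a n != 0 -> monic_orth a n p ->
  p`_0 = (-1) ^+ n * gram (shift_col a) n / gram a n.
Proof.
move=> nz pP; have [q qP <-] := monic_orth_exists nz.
by rewrite (monic_orth_uniq nz pP qP).
Qed.

(** By [momentXM], ['X * q] has the same moments against row [m] of [a] as [q] against row [m] of
    [shift_col a]. The constant specialises to [delta] for [P_kernel] and to [beta] for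
    [Q_kernel]. *)
Lemma monic_orth_shift_col a n p0 p1 q :
  gram a n != 0 -> gram a n.+1 != 0 -> gram (shift_col a) n != 0 ->
  monic_orth a n p0 -> monic_orth a n.+1 p1 -> monic_orth (shift_col a) n q ->
  'X * q = p1 - (- (gram (shift_col a) n.+1 / gram (shift_col a) n
                    / (gram a n.+1 / gram a n))) *: p0.
Proof.
move=> nz nz1 nzC p0P p1P qP.
have [[_ sp1 p1_orth] [_ sq q_orth]] := (p1P, qP).
have : 'X * q - p1 = ('X * q - p1)`_n *: p0.
  apply: (orth_scale nz p0P) => [|m mn].
    apply/leq_sizeP => k; rewrite leq_eqVlt coefB coefXM => /predU1P[<-|nk].
      by rewrite /= (monic_orth_coef p1P) (monic_orth_coef qP) subrr.
    by case: k nk => // k nk; rewrite !nth_default ?sq ?sp1 ?subrr // ltnW.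
  by rewrite momentB momentXM p1_orth ?subr0 ?q_orth // ltnS ltnW.
move: (_`_n) => c E; rewrite -[LHS](subrKC p1) E -scaleNr; congr (_ + _ *: _).
move/(congr1 (fun p : {poly F} => p`_0)): E.
rewrite coefB coefXM sub0r coefZ (monic_orth_coef0 nz1 p1P).
rewrite (monic_orth_coef0 nz p0P) exprS => cE.
have s0 : (-1) ^+ n != 0 :> F by rewrite signr_eq0.
(* Multiplying by the constant coefficient of [p0], nonzero by [nzC], turns the unknown [c] into the
   product given by [cE]. *)
apply: (mulIf s0); apply: (mulIf (mulf_neq0 nzC (invr_neq0 nz))).
rewrite -[LHS]mulrA [_ ^+ n * _]mulrA -cE; field.
by rewrite nz nz1 nzC.
Qed.

(** Rows 0 to n-1 of [shift_row a] are rows 1 to n of [a], so [p] is orthogonal to all of them. In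
    the constant, the first term comes from [q1] at 0 and the second, which becomes [eta] or
    [alpha], from [p] at 0. *)
Lemma monic_orth_shift_row a n p q0 q1 :
  gram a n.+1 != 0 -> gram (shift_row a) n != 0 ->
  gram (shift_row a) n.+1 != 0 -> gram (shift_col (shift_row a)) n != 0 ->
  monic_orth a n.+1 p ->
  monic_orth (shift_row a) n q0 -> monic_orth (shift_row a) n.+1 q1 ->
  p = q1 - (- (gram (shift_col (shift_row a)) n.+1
               / gram (shift_col (shift_row a)) n
               / (gram (shift_row a) n.+1 / gram (shift_row a) n))
            + gram (shift_row a) n * gram (shift_col a) n.+1
              / (gram a n.+1 * gram (shift_col (shift_row a)) n)) *: q0.
Proof.
move=> nz nzR nzR1 nzC pP q0P q1P.
have [[_ sp p_orth] [_ sq1 q1_orth]] := (pP, q1P).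
have : p - q1 = (p - q1)`_n *: q0.
  apply: (orth_scale nzR q0P) => [|m mn].
    apply/leq_sizeP => k; rewrite leq_eqVlt coefB => /predU1P[<-|nk].
      by rewrite (monic_orth_coef pP) (monic_orth_coef q1P) subrr.
    by rewrite !nth_default ?sp ?sq1 ?subrr.
  by rewrite momentB q1_orth ?p_orth ?subrr // ltnS ltnW.
move: (_`_n) => c E; rewrite -[LHS](subrKC q1) E -scaleNr; congr (_ + _ *: _).
move/(congr1 (fun p : {poly F} => p`_0)): E.
rewrite coefB coefZ (monic_orth_coef0 nz pP).
rewrite (monic_orth_coef0 nzR q0P) (monic_orth_coef0 nzR1 q1P).
rewrite exprS => cE.
have s0 : (-1) ^+ n != 0 :> F by rewrite signr_eq0.
apply: (mulIf s0); apply: (mulIf (mulf_neq0 nzC (invr_neq0 nzR))).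
rewrite -[LHS]mulrA [_ ^+ n * _]mulrA -cE; field.
by rewrite nz nzR nzR1 nzC.
Qed.

End MonicOrthogonal.

(** * Integrability on the circle and linearity of the circle integral *)

Section CircleIntegral.
Variable R : realType.
Implicit Types (f g w : R[i] -> R[i]) (t : R) (c : R[i]).

Lemma ReM (x y : R[i]) :
  complex.Re (x * y) =
    complex.Re x * complex.Re y - complex.Im x * complex.Im y.
Proof. by case: x y => [a b] [a' b']. Qed.

Lemma ImM (x y : R[i]) :
  complex.Im (x * y) =
    complex.Re x * complex.Im y + complex.Im x * complex.Re y.
Proof. by case: x y => [a b] [a' b']. Qed.

Lemma circle_pt_neq0 t : circle_pt t != 0 :> R[i].
Proof.
apply/eqP => -[ct st]; have /eqP := cos2Dsin2 t.
by rewrite ct st expr0n addr0 eq_sym oner_eq0.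
Qed.

Lemma circle_ptV t : (circle_pt t)^-1 = cos t +i* - sin t.
Proof.
apply: (mulfI (circle_pt_neq0 t)); rewrite divff ?circle_pt_neq0 //.
apply/eqP; rewrite eq_complex /=; apply/andP; split; apply/eqP; last by ring.
by rewrite -(cos2Dsin2 t); ring.
Qed.

(** The circle avoids 0, so integer powers of z may be combined under the integral sign. *)
Lemma circle_integral_eq f g :
  (forall z, z != 0 -> f z = g z) -> circle_integral f = circle_integral g.
Proof.
move=> fg; rewrite /circle_integral /contour_integral; congr cintegral.
by apply/funext => t; rewrite fg ?circle_pt_neq0.
Qed.

Lemma integrable_weight_eq f g :
  (forall z, z != 0 -> f z = g z) -> integrable_weight f -> integrable_weight g.
Proof.
move=> fg [fR fI]; split.
  by apply: eq_integrable fR => // t _; rewrite fg ?circle_pt_neq0.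
by apply: eq_integrable fI => // t _; rewrite fg ?circle_pt_neq0.
Qed.

Lemma integrable_weightD f g : integrable_weight f -> integrable_weight g ->
  integrable_weight (fun z => f z + g z).
Proof.
move=> [fR fI] [gR gI]; split.
  by apply: eq_integrable (integrableD _ fR gR) => // t _; rewrite raddfD.
by apply: eq_integrable (integrableD _ fI gI) => // t _; rewrite raddfD.
Qed.

(** The real and imaginary parts of the product are combinations of products of a bounded measurable
    function with an integrable one. *)
Lemma integrable_weightM (a b : R -> R) (M : R) f g :
  (forall t, f (circle_pt t) = a t +i* b t) ->
  measurable_fun setT a -> measurable_fun setT b ->
  (forall t, `|a t| <= M) -> (forall t, `|b t| <= M) ->
  integrable_weight g -> integrable_weight (fun z => f z * g z).
Proof.
move=> fE ma mb aM bM [gR gI].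
have bnd (h : R -> R) : (forall t, `|h t| <= M) ->
    [bounded h t | t in `[0, pi *+ 2]%classic].
  move=> hM; exists M; split; first exact: num_real.
  by move=> x Mx t _; exact: le_trans (hM t) (ltW Mx).
have mI (h : R -> R) : measurable_fun setT h ->
    measurable_fun `[0, pi *+ 2]%classic h.
  exact: measurable_funS.
have int (h : R -> R) G : measurable_fun setT h -> (forall t, `|h t| <= M) ->
    lebesgue_measure.-integrable `[0, pi *+ 2]%classic G ->
    lebesgue_measure.-integrable `[0, pi *+ 2]%classic ((EFin \o h) \* G)%E.
  move=> mh hM; apply: integrableMr; [exact: measurable_itv | exact: mI |].
  exact: bnd.
split.
  apply: eq_integrable
    (integrableB _ (int _ _ ma aM gR) (int _ _ mb bM gI)) => //.
  by move=> t _; rewrite ReM fE.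
apply: eq_integrable
  (integrableD _ (int _ _ ma aM gI) (int _ _ mb bM gR)) => //.
by move=> t _; rewrite ImM fE.
Qed.

Lemma integrable_weightZ c f :
  integrable_weight f -> integrable_weight (fun z => c * f z).
Proof.
case: c => x y; apply: (@integrable_weightM (cst x) (cst y)
  (Num.max `|x| `|y|)) => // t; first by rewrite le_max lexx.
by rewrite le_max lexx orbT.
Qed.

Lemma integrable_weightXz w (j : int) :
  integrable_weight w -> integrable_weight (fun z => z ^ j * w z).
Proof.
have mcos : measurable_fun setT (@cos R).
  by apply: measurable_realfun.continuous_measurable_fun; exact: continuous_cos.
have msin : measurable_fun setT (@sin R).
  by apply: measurable_realfun.continuous_measurable_fun; exact: continuous_sin.
(* Each step multiplies by zeta or by its inverse, which is its conjugate on the circle; the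
   components of both are bounded by 1. *)
move=> wi; elim/int_ind: j => [|n IH|n IH].
- by apply: integrable_weight_eq wi => z _; rewrite expr0z mul1r.
- apply: integrable_weight_eq (integrable_weightM (f := id) (fun=> erefl)
    mcos msin (@cos_max R) (@sin_max R) IH) => z z0.
  by rewrite mulrA -exprSz.
- have mNsin : measurable_fun setT (fun t : R => - sin t).
    exact: measurable_realfun.measurable_funN.
  have Nsin_max t : `|- sin t| <= 1 by rewrite normrN sin_max.
  apply: integrable_weight_eq (integrable_weightM (f := GRing.inv) circle_ptV
    mcos mNsin (@cos_max R) Nsin_max IH) => z z0.
  by rewrite mulrA; congr (_ * _); rewrite -!exprnN exprS invfM.
Qed.

(** The factor i zeta of d zeta cancels against the denominator, leaving the mean over [0, 2 pi]. *)
Lemma circle_integralE f : integrable_weight f ->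
  circle_integral f =
    (pi *+ 2)^-1%:C * cintegral `[0, pi *+ 2]%classic (f \o @circle_pt R).
Proof.
move=> [fR fI]; rewrite /circle_integral /contour_integral.
have pi2 : pi *+ 2 != 0 :> R by rewrite mulrn_eq0 /= gt_eqF ?pi_gt0.
transitivity (cintegral `[0, pi *+ 2]%classic
    (fun t => (pi *+ 2)^-1%:C * f (circle_pt t))).
  congr cintegral; apply/funext => t.
  have i0 := @neq0Ci R[i]. have t0 := circle_pt_neq0 t.
  have p0 : (pi *+ 2)%:C != 0 :> R[i] by rewrite eq_complex /= negb_and pi2.
  rewrite fmorphV -[_ * circle_pt t in X in X * _]mulrA invfM [f _ * _]mulrA.
  by rewrite divfK ?mulf_neq0 // mulrC.
rewrite /cintegral; apply/eqP; rewrite eq_complex ReM ImM /= !mul0r subr0 addr0.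
apply/andP.
split; apply/eqP; rewrite -RintegralZl //; apply: eq_Rintegral => t _.
  by rewrite ReM mul0r subr0.
by rewrite ImM mul0r addr0.
Qed.

Lemma circle_integralD f g : integrable_weight f -> integrable_weight g ->
  circle_integral (fun z => f z + g z) = circle_integral f + circle_integral g.
Proof.
move=> fi gi; rewrite !circle_integralE //; last exact: integrable_weightD.
rewrite -mulrDr; congr (_ * _); case: fi gi => [fR fI] [gR gI].
apply/eqP; rewrite eq_complex /=; apply/andP.
split; apply/eqP; rewrite -RintegralD //; apply: eq_Rintegral => t _.
  by rewrite /= raddfD.
by rewrite /= raddfD.
Qed.

Lemma circle_integralZ c f : integrable_weight f ->
  circle_integral (fun z => c * f z) = c * circle_integral f.
Proof.
move=> fi; rewrite !circle_integralE //; last exact: integrable_weightZ.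
rewrite mulrCA; congr (_ * _); case: fi => [fR fI].
have Z x (g : R -> R) :
    lebesgue_measure.-integrable `[0, pi *+ 2]%classic (EFin \o g) ->
    lebesgue_measure.-integrable `[0, pi *+ 2]%classic
      (EFin \o (fun t : R => x * g t)) by exact: integrableZl.
apply/eqP; rewrite eq_complex ReM ImM /=; apply/andP.
split; apply/eqP; rewrite -!RintegralZl //.
  by rewrite -RintegralB ?Z //; apply: eq_Rintegral => t _; rewrite ReM.
by rewrite -RintegralD ?Z //; apply: eq_Rintegral => t _; rewrite ImM.
Qed.

Lemma circle_integral_sum n (c : nat -> R[i]) (f : nat -> R[i] -> R[i]) :
  (forall k, integrable_weight (f k)) ->
  circle_integral (fun z => \sum_(k < n) c k * f k z) =
  \sum_(k < n) c k * circle_integral (f k).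
Proof.
move=> fi.
(* Integrability of the partial sums is carried through the induction, since additivity of the
   integral asks for it. *)
suff [] : integrable_weight (fun z => \sum_(k < n) c k * f k z) /\
  circle_integral (fun z => \sum_(k < n) c k * f k z) =
  \sum_(k < n) c k * circle_integral (f k) by [].
elim: n => [|n [IHi IH]].
  (* The empty sum is written as 0 times an integrable function, so that the scaling lemmas cover
     the base case. *)
  have E (z : R[i]) : 0 * f 0%N z = \sum_(k < 0) c k * f k z.
    by rewrite big_ord0 mul0r.
  split.
    by apply: integrable_weight_eq (integrable_weightZ 0 (fi 0%N)) => z _.
  transitivity (circle_integral (fun z => 0 * f 0%N z)).
    by apply: circle_integral_eq => z _; rewrite E.
  by rewrite circle_integralZ // mul0r big_ord0.
have cfi := integrable_weightZ (c n) (fi n).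
split.
  apply: integrable_weight_eq (integrable_weightD IHi cfi) => z _.
  by rewrite big_ord_recr.
rewrite big_ord_recr /= -IH -circle_integralZ // -circle_integralD //.
by apply: circle_integral_eq => z _; rewrite big_ord_recr.
Qed.

End CircleIntegral.

(** Here p_i stands for P_{n+i}(r), q_i for P_{n+i}(r-1) and s for P_{n+1}(r-2). Computing X^2 s in
    two ways eliminates the q_i and s. *)
Lemma P_recurrence_of_contiguous (K : comNzRingType) (z a b c d : K)
    (p0 p1 p2 p3 q1 q2 s : {poly K}) :
  'X * q2 = p3 - a *: p2 -> 'X * q1 = p2 - b *: p1 ->
  'X * s = q2 - c *: q1 -> s = p1 - d *: p0 ->
  p3.[z] - (a + c) * p2.[z] + (c * b - z ^+ 2) * p1.[z]
    + d * z ^+ 2 * p0.[z] = 0.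
Proof.
move=> E1 E2 E3 E4.
have : 'X * ('X * s) = p3 - a *: p2 - c *: (p2 - b *: p1).
  by rewrite E3 mulrBr E1 -scalerAr E2.
rewrite E4 => /(congr1 (horner^~ z)) /eqP.
rewrite -subr_eq0 !(hornerM, hornerX, hornerD, hornerN, hornerZ) => /eqP E5.
by rewrite -[RHS]oppr0 -E5; ring.
Qed.

(** Here q_i stands for Q*_{n+i}(r), s_i for Q*_{n+i}(r+1) and t for Q*_{n+2}(r+2). The recurrence
    equates two expressions for t. *)
Lemma Qstar_recurrence_of_contiguous (K : comNzRingType) (z b a1 a2 a3 : K)
    (q0 q1 q2 q3 s1 s2 t : {poly K}) :
  t = q3 - b *: ('X * q2) -> s2 = q2 - a1 *: ('X * q1) ->
  s1 = q1 - a3 *: ('X * q0) -> t = s2 - a2 *: ('X * s1) ->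
  q3.[z] - (1 + b * z) * q2.[z] + (a1 + a2) * z * q1.[z]
    - a2 * a3 * z ^+ 2 * q0.[z] = 0.
Proof.
move=> -> -> -> /(congr1 (horner^~ z)) /eqP.
rewrite -subr_eq0 !(hornerM, hornerX, hornerD, hornerN, hornerZ) => /eqP E.
by rewrite -[RHS]E; ring.
Qed.

(** * The Toeplitz kernels and the contiguous relations in r *)

Section Toeplitz.
Variables (R : realType) (w : R[i] -> R[i]).
Hypothesis w_int : integrable_weight w.
Implicit Types (n : nat) (r : int) (p q : {poly R[i]}).

Definition P_kernel r (m k : nat) : R[i] :=
  fourier_coef w (r + 2 * m%:Z - k%:Z).
Definition Q_kernel r (m k : nat) : R[i] :=
  fourier_coef w (r + 2 * k%:Z - m%:Z).

Lemma gram_P_kernel r n : gram (P_kernel r) n = D w n r.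
Proof. by []. Qed.

Lemma gram_Q_kernel r n : gram (Q_kernel r) n = D w n r.
Proof.
by rewrite /gram -det_tr; congr (\det _); apply/matrixP => j k; rewrite !mxE.
Qed.

(** This and the next three identities show that each kernel family is stable under index shifts,
    which only change r. *)
Lemma shift_col_P_kernel r : shift_col (P_kernel r) = P_kernel (r - 1).
Proof. by apply/funext => m; apply/funext => k; congr fourier_coef; lia. Qed.

Lemma shift_row_P_kernel r : shift_row (P_kernel r) = P_kernel (r + 2).
Proof. by apply/funext => m; apply/funext => k; congr fourier_coef; lia. Qed.

Lemma shift_col_Q_kernel r : shift_col (Q_kernel r) = Q_kernel (r + 2).
Proof. by apply/funext => m; apply/funext => k; congr fourier_coef; lia. Qed.

Lemma shift_row_Q_kernel r : shift_row (Q_kernel r) = Q_kernel (r - 1).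
Proof. by apply/funext => m; apply/funext => k; congr fourier_coef; lia. Qed.

Lemma moment_P_kernel r m p :
  circle_integral (fun z => p.[z] * z ^ (- 2 * m%:Z - r) * w z) =
  moment (P_kernel r m) p.
Proof.
have wi k := integrable_weightXz (- (r + 2 * m%:Z - Posz k)) w_int.
apply: etrans (circle_integral_sum (size p) (fun k => p`_k) wi).
apply: circle_integral_eq => z z0; rewrite horner_coef !mulr_suml.
apply: eq_bigr => k _; rewrite -!mulrA; congr (_ * _); rewrite mulrA.
by congr (_ * _); rewrite -[z ^+ k]/(z ^ k%:Z) -expfzDr //; congr (_ ^ _); lia.
Qed.

Lemma moment_Q_kernel r m q :
  circle_integral (fun z => q.[z ^- 2] * z ^ (m%:Z - r) * w z) =
  moment (Q_kernel r m) q.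
Proof.
have wi k := integrable_weightXz (- (r + 2 * Posz k - m%:Z)) w_int.
apply: etrans (circle_integral_sum (size q) (fun k => q`_k) wi).
apply: circle_integral_eq => z z0; rewrite horner_coef !mulr_suml.
apply: eq_bigr => k _; rewrite -!mulrA; congr (_ * _); rewrite mulrA.
congr (_ * _); rewrite -exprVn -exprM [_ ^+ (_ * _)]exprnP exprz_inv.
rewrite -expfzDr //.
by congr (_ ^ _); lia.
Qed.

Lemma P_monic_orth n r : D w n r != 0 -> monic_orth (P_kernel r) n (P w n r).
Proof.
move=> nz; have [p [mp sp p_orth] _] := monic_orth_exists (a := P_kernel r) nz.
(* Existence rules out the default value 0 of [xget], so [P w n r] does satisfy its defining
   conditions. *)
have [|? ? P_orth] := @xgetPex _ 0 [set p | is_P w n r p]%classic.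
  by exists p; split=> // m mn; rewrite moment_P_kernel p_orth.
by split=> // m mn; rewrite -moment_P_kernel P_orth.
Qed.

Lemma Q_monic_orth n r : D w n r != 0 -> monic_orth (Q_kernel r) n (Q w n r).
Proof.
rewrite -gram_Q_kernel => nz; have [q [mq sq q_orth] _] := monic_orth_exists nz.
have [|? ? Q_orth] := @xgetPex _ 0 [set q | is_Q w n r q]%classic.
  by exists q; split=> // m mn; rewrite moment_Q_kernel q_orth.
by split=> // m mn; rewrite -moment_Q_kernel Q_orth.
Qed.

Lemma P_contiguous1 n r :
  D w n r != 0 -> D w n.+1 r != 0 -> D w n (r - 1) != 0 ->
  'X * P w n (r - 1) = P w n.+1 r - delta w n r *: P w n r.
Proof.
move=> nz nz1 nzC; have := monic_orth_shift_col (a := P_kernel r) (n := n).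
rewrite shift_col_P_kernel !gram_P_kernel; apply=> //.
- exact: P_monic_orth nz.
- exact: P_monic_orth nz1.
exact: P_monic_orth nzC.
Qed.

(** The row shift is applied to the kernel at r-2, whose shifted rows give the kernel at r. The
    column shift of the former sits at r-3, which is where [eta] at r-2 gets its last determinant in
    the numerator. *)
Lemma P_contiguous2 n r :
  D w n r != 0 -> D w n.+1 r != 0 -> D w n (r - 1) != 0 ->
  D w n.+1 (r - 2) != 0 ->
  P w n.+1 (r - 2) = P w n.+1 r - (delta w n r + eta w n (r - 2)) *: P w n r.
Proof.
move=> nz nz1 nzC nzR.
have rowE : shift_row (P_kernel (r - 2)) = P_kernel r.
  by rewrite shift_row_P_kernel subrK.
have := monic_orth_shift_row (a := P_kernel (r - 2)) (n := n).
rewrite rowE !shift_col_P_kernel !gram_P_kernel.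
move=> /(_ _ _ _ nzR nz nz1 nzC (P_monic_orth nzR) (P_monic_orth nz)
          (P_monic_orth nz1)) ->.
by rewrite /delta /h /eta subrK (_ : r - 2 + 1 = r - 1); last by lia.
Qed.

(** * Reversal of coefficients, and the relations for Q* *)

Lemma reciprocalD n p q :
  reciprocal n (p + q) = reciprocal n p + reciprocal n q.
Proof.
apply/polyP => i; rewrite coefD !coef_poly.
by case: ifP => _; rewrite ?coefD ?addr0.
Qed.

Lemma reciprocalZ n c p : reciprocal n (c *: p) = c *: reciprocal n p.
Proof.
apply/polyP => i; rewrite coefZ !coef_poly.
by case: ifP => _; rewrite ?coefZ ?mulr0.
Qed.

Lemma reciprocalXM n p : reciprocal n.+1 ('X * p) = reciprocal n p.
Proof.
apply/polyP => i; rewrite !coef_poly coefXM ltnS leq_eqVlt.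
case: (ltnP i n.+1) => ni; first by rewrite orbT subSn.
(* The extra index n+1 picks the constant coefficient of ['X * p], which is 0. *)
by case: eqP => //= ->; rewrite subnn.
Qed.

Lemma reciprocalS n p :
  (size p <= n.+1)%N -> reciprocal n.+1 p = 'X * reciprocal n p.
Proof.
move=> sp; apply/polyP => -[|i]; rewrite coefXM !coef_poly //=.
by rewrite nth_default.
Qed.

(** Reversal in degree n+1 removes the factor X from the left side of the relation for Q and
    attaches one to Q_n on the right. *)
Lemma Qstar_contiguous1 n r :
  D w n r != 0 -> D w n.+1 r != 0 -> D w n (r + 2) != 0 ->
  Qstar w n (r + 2) = Qstar w n.+1 r - beta w n r *: ('X * Qstar w n r).
Proof.
move=> nz nz1 nzC; have [_ sq _] := Q_monic_orth nz.
have := monic_orth_shift_col (a := Q_kernel r) (n := n).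
rewrite shift_col_Q_kernel !gram_Q_kernel.
move=> /(_ _ _ _ nz nz1 nzC (Q_monic_orth nz) (Q_monic_orth nz1)
          (Q_monic_orth nzC)) E.
rewrite /Qstar -reciprocalXM E -scaleNr reciprocalD reciprocalZ.
by rewrite [reciprocal n.+1 (Q w n r)]reciprocalS ?sq // scaleNr.
Qed.

(** The row shift goes from the kernel at r+1 to the one at r; reversal in degree n+1 then puts the
    factor X on Q*_n only. *)
Lemma Qstar_contiguous2 n r :
  D w n r != 0 -> D w n.+1 r != 0 -> D w n (r + 2) != 0 ->
  D w n.+1 (r + 1) != 0 ->
  Qstar w n.+1 (r + 1) =
    Qstar w n.+1 r - (beta w n r + alpha w n (r + 1)) *: ('X * Qstar w n r).
Proof.
move=> nz nz1 nzC nzR; have [_ sq _] := Q_monic_orth nz.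
have rowE : shift_row (Q_kernel (r + 1)) = Q_kernel r.
  by rewrite shift_row_Q_kernel addrK.
have := monic_orth_shift_row (a := Q_kernel (r + 1)) (n := n).
rewrite rowE !shift_col_Q_kernel !gram_Q_kernel.
move=> /(_ _ _ _ nzR nz nz1 nzC (Q_monic_orth nzR) (Q_monic_orth nz)
          (Q_monic_orth nz1)) E.
rewrite /Qstar E -scaleNr reciprocalD reciprocalZ.
rewrite [reciprocal n.+1 (Q w n r)]reciprocalS ?sq //.
rewrite -[in RHS]scaleNr /beta /h /alpha addrK.
by rewrite (_ : r + 1 + 1 = r + 2); last by lia.
Qed.

End Toeplitz.

Theorem theorem4p1 (R : realType) (w : R[i] -> R[i])
    (w_int : integrable_weight w) (n : nat) (r : int) :
  ((forall m : nat, (n <= m <= n + 3)%N -> D w m r != 0) ->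
   (forall m : nat, (n <= m <= n + 2)%N -> D w m (r - 1) != 0) ->
   D w (n + 1) (r - 2) != 0 ->
   forall z : R[i],
     (P w (n + 3) r).[z]
     - (delta w (n + 2) r + delta w (n + 1) (r - 1)) * (P w (n + 2) r).[z]
     + (delta w (n + 1) (r - 1) * delta w (n + 1) r - z ^+ 2)
         * (P w (n + 1) r).[z]
     + (delta w n r + eta w n (r - 2)) * z ^+ 2 * (P w n r).[z] = 0)
  /\
  ((forall m : nat, (n <= m <= n + 3)%N -> D w m r != 0) ->
   (forall m : nat, (n + 1 <= m <= n + 2)%N -> D w m (r + 1) != 0) ->
   (forall m : nat, (n <= m <= n + 2)%N -> D w m (r + 2) != 0) ->
   D w (n + 1) (r + 3) != 0 ->
   forall z : R[i],
     (Qstar w (n + 3) r).[z]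
     - (1 + beta w (n + 2) r * z) * (Qstar w (n + 2) r).[z]
     + (beta w (n + 1) r + alpha w (n + 1) (r + 1)
        + beta w (n + 1) (r + 1) + alpha w (n + 1) (r + 2))
         * z * (Qstar w (n + 1) r).[z]
     - (beta w (n + 1) (r + 1) + alpha w (n + 1) (r + 2))
         * (beta w n r + alpha w n (r + 1)) * z ^+ 2 * (Qstar w n r).[z] = 0).
Proof.
rewrite ![(n + _)%N]addnS !addn0; split.
  move=> Dr Dr1 Dr2 z.
  have r2E : r - 1 - 1 = r - 2 by lia.
  have := P_contiguous1 w_int (Dr1 n.+1 ltac:(lia)) (Dr1 n.+2 ltac:(lia)).
  rewrite r2E => /(_ Dr2) E3.
  apply: P_recurrence_of_contiguous E3 _.
  - exact: P_contiguous1 (Dr n.+2 ltac:(lia)) (Dr n.+3 ltac:(lia))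
      (Dr1 n.+2 ltac:(lia)).
  - exact: P_contiguous1 (Dr n.+1 ltac:(lia)) (Dr n.+2 ltac:(lia))
      (Dr1 n.+1 ltac:(lia)).
  exact: P_contiguous2 (Dr n ltac:(lia)) (Dr n.+1 ltac:(lia))
    (Dr1 n ltac:(lia)) Dr2.
move=> Dr Dr1 Dr2 Dr3 z.
have r2E : r + 1 + 1 = r + 2 by lia.
have r3E : r + 1 + 2 = r + 3 by lia.
have := Qstar_contiguous2 w_int (Dr1 n.+1 ltac:(lia)) (Dr1 n.+2 ltac:(lia)).
rewrite r2E r3E => /(_ Dr3 (Dr2 n.+2 ltac:(lia))) E4.
(* The four summands are grouped in pairs: beta + alpha from the relation at r, and beta + alpha
   from the one at r+1. *)
rewrite -[X in X * z * _]addrA; apply: Qstar_recurrence_of_contiguous _ _ _ E4.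
- exact: Qstar_contiguous1 (Dr n.+2 ltac:(lia)) (Dr n.+3 ltac:(lia))
    (Dr2 n.+2 ltac:(lia)).
- exact: Qstar_contiguous2 (Dr n.+1 ltac:(lia)) (Dr n.+2 ltac:(lia))
    (Dr2 n.+1 ltac:(lia)) (Dr1 n.+2 ltac:(lia)).
exact: Qstar_contiguous2 (Dr n ltac:(lia)) (Dr n.+1 ltac:(lia))
  (Dr2 n ltac:(lia)) (Dr1 n.+1 ltac:(lia)).
Qed.
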